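(* Let $p$ be a prime and let $C(x_1,\ldots,x_r)=\sum_{i,j,k=1}^r a_{ijk}x_ix_jx_k$ be a non-degenerate cubic form with integer coefficients $a_{ijk}$ that is primitive, in $r>9$ variables. Then $R(C)$ is dense in $\mathbb{Q}_p$.
   Context: $C$ is primitive if no integer $d>1$ divides all $a_{ijk}$. Two cubic forms $C_1,C_2$ over $\mathbb{Q}_p$ are equivalent if $C_1(\overline{x})=C_2(T\overline{x})$ for some non-singular linear transformation $T$ over $\mathbb{Q}_p$; the order of $C$ is the least $m$ such that $C$ is equivalent (over $\mathbb{Q}_p$) to a form explicitly involving only $m$ variables, and a cubic form in $n$ variables is non-degenerate if its order equals $n$. $R(C)=\{C(\overline{x})/C(\overline{y}) : \overline{x},\overline{y}\in\mathbb{Z}^r,\ C(\overline{y})\neq 0\}$, with density in the $p$-adic topology. *)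

(* Defs.v *)
From HB Require Import structures.
From mathcomp Require Import all_boot all_order all_algebra.
From mathcomp Require Import fraction.
From mathcomp Require Import boolp classical_sets topology.
From mathcomp Require mpoly.

Set Implicit Arguments.
Unset Strict Implicit.
Unset Printing Implicit Defensive.

Import GRing.Theory.

Local Open Scope ring_scope.

(* Z_p is the inverse limit of the Z/p^n: an element is a sequence of residues
   x_n in {0, ..., p^n - 1} with x_(n+1) = x_n mod p^n.  The equation below
   also enforces x_n < p^n.  The primality proof is a parameter of the type so
   that the integral domain structure can be attached to it. *)
Record padic_int (p : nat) (p_pr : prime p) := PadicInt {
  padic_residue :> nat -> nat;
  padic_residueP :
    forall n, (padic_residue n.+1 %% p ^ n)%N = padic_residue n }.

Section PadicInt.
Variables (p : nat) (p_pr : prime p).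
Local Notation Zp := (padic_int p_pr).
Implicit Types x y z : Zp.

HB.instance Definition _ := gen_eqMixin Zp.
HB.instance Definition _ := gen_choiceMixin Zp.

Lemma padic_int_ext x y : x =1 y -> x = y.
Proof.
case: x y => [x xP] [y yP] /= /funext exy; rewrite -{}exy in yP *.
by congr PadicInt; exact: Prop_irrelevance.
Qed.

Lemma padic_residue_mod x n : (x n %% p ^ n)%N = x n.
Proof. by rewrite -padic_residueP modn_mod. Qed.

Lemma padic_residue_le x n m : (n <= m)%N -> (x m %% p ^ n)%N = x n.
Proof.
move/subnK <-; elim: (m - n)%N => [|k IHk]; first exact: padic_residue_mod.
by rewrite -IHk -(padic_residueP x (k + n)) modn_dvdm // dvdn_exp2l ?leq_addl.
Qed.

Fact padic_mk_subproof (f : nat -> nat) :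
  (forall n, f n.+1 = f n %[mod p ^ n]) ->
  forall n, (f n.+1 %% p ^ n.+1 %% p ^ n)%N = (f n %% p ^ n)%N.
Proof. by move=> fP n; rewrite modn_dvdm ?dvdn_exp2l // fP. Qed.

Definition padic_mk f fP : Zp := PadicInt p_pr (@padic_mk_subproof f fP).

Fact padic_const_subproof k n : k = k %[mod p ^ n]. Proof. by []. Qed.
Definition padic_const k : Zp := padic_mk (padic_const_subproof k).

Fact padic_add_subproof x y n :
  (x n.+1 + y n.+1)%N = (x n + y n)%N %[mod p ^ n].
Proof. by rewrite -modnDm !padic_residueP. Qed.
Definition padic_add x y : Zp := padic_mk (padic_add_subproof x y).

Fact padic_mul_subproof x y n :
  (x n.+1 * y n.+1)%N = (x n * y n)%N %[mod p ^ n].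
Proof. by rewrite -modnMm !padic_residueP. Qed.
Definition padic_mul x y : Zp := padic_mk (padic_mul_subproof x y).

Lemma padic_residue_lt x n : (x n < p ^ n)%N.
Proof. by rewrite -padic_residue_mod ltn_mod expn_gt0 prime_gt0. Qed.

Fact padic_opp_subproof x n :
  (p ^ n.+1 - x n.+1)%N = (p ^ n - x n)%N %[mod p ^ n].
Proof.
apply/eqP; rewrite -(eqn_modDr (x n.+1)) subnK ?(ltnW (padic_residue_lt _ _)) //.
rewrite -modnDmr padic_residueP subnK ?(ltnW (padic_residue_lt _ _)) //.
by rewrite modnn expnS modnMl.
Qed.
Definition padic_opp x : Zp := padic_mk (padic_opp_subproof x).

Fact padic_addA : associative padic_add.
Proof. by move=> x y z; apply: padic_int_ext => n /=; rewrite modnDml modnDmr addnA. Qed.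
Fact padic_addC : commutative padic_add.
Proof. by move=> x y; apply: padic_int_ext => n /=; rewrite addnC. Qed.
Fact padic_add0 : left_id (padic_const 0) padic_add.
Proof. by move=> x; apply: padic_int_ext => n /=; rewrite modnDml padic_residue_mod. Qed.
Fact padic_addN : left_inverse (padic_const 0) padic_opp padic_add.
Proof.
move=> x; apply: padic_int_ext => n /=.
by rewrite modnDml subnK ?(ltnW (padic_residue_lt _ _)) // modnn mod0n.
Qed.

HB.instance Definition _ :=
  GRing.isZmodule.Build Zp padic_addA padic_addC padic_add0 padic_addN.

Fact padic_mulA : associative padic_mul.
Proof. by move=> x y z; apply: padic_int_ext => n /=; rewrite modnMml modnMmr mulnA. Qed.
Fact padic_mulC : commutative padic_mul.
Proof. by move=> x y; apply: padic_int_ext => n /=; rewrite mulnC. Qed.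
Fact padic_mul1 : left_id (padic_const 1) padic_mul.
Proof.
by move=> x; apply: padic_int_ext => n /=; rewrite modnMml mul1n padic_residue_mod.
Qed.
Fact padic_mulDl : left_distributive padic_mul padic_add.
Proof.
by move=> x y z; apply: padic_int_ext => n /=; rewrite modnMml modnDm mulnDl.
Qed.
Fact padic_1neq0 : padic_const 1 != 0.
Proof.
apply/eqP => /(congr1 (fun x : Zp => x 1%N)) /=.
by rewrite expn1 mod0n modn_small ?prime_gt1.
Qed.

HB.instance Definition _ := GRing.Zmodule_isComNzRing.Build Zp
  padic_mulA padic_mulC padic_mul1 padic_mulDl padic_1neq0.

Definition padic_unit : pred Zp := fun x => `[< exists y, y * x = 1 >].
Definition padic_inv x : Zp :=
  if pselect (exists y, y * x = 1) is left ex then sval (cid ex) else x.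

Fact padic_mulVx : {in padic_unit, left_inverse 1 padic_inv *%R}.
Proof.
move=> x /asboolP xU; rewrite /padic_inv; case: pselect => // ex.
by case: (cid ex).
Qed.
Fact padic_unitPl x y : y * x = 1 -> padic_unit x.
Proof. by move=> yx1; apply/asboolP; exists y. Qed.
Fact padic_inv_out : {in [predC padic_unit], padic_inv =1 id}.
Proof.
by move=> x /asboolP xU; rewrite /padic_inv; case: pselect => // ex; case: xU.
Qed.

HB.instance Definition _ := GRing.ComNzRing_hasMulInverse.Build Zp
  padic_mulVx padic_unitPl padic_inv_out.

Lemma padic_neq0P x : x != 0 -> exists n, x n != 0%N.
Proof.
move=> x0; apply/not_existsP => xn; case/eqP: x0; apply: padic_int_ext => n.
by have /negP/negPn/eqP -> := xn n; rewrite /= mod0n.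
Qed.

Fact padic_integral : GRing.integral_domain_axiom Zp.
Proof.
move=> x y xy0; apply/negPn/negP; rewrite negb_or => /andP[].
move=> /padic_neq0P[n xn] /padic_neq0P[m ym].
have := congr1 (fun x : Zp => x (n + m)%N) xy0; rewrite /= mod0n => /eqP.
have [xk yk] : x (n + m)%N != 0%N /\ y (n + m)%N != 0%N.
  split; [apply: contra_neq xn | apply: contra_neq ym] => e0.
    by rewrite -(padic_residue_le x (leq_addr m n)) e0 mod0n.
  by rewrite -(padic_residue_le y (leq_addl n m)) e0 mod0n.
apply/negP; rewrite -/(dvdn _ _) pfactor_dvdn ?muln_gt0 ?lt0n ?xk // lognM ?lt0n //.
rewrite -ltnNge -addSn; apply: leq_ltn_trans (leqnn _) _.
have lx : (logn p (x (n + m)%N) < n)%N.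
  rewrite ltnNge -pfactor_dvdn ?lt0n //.
  by rewrite /dvdn padic_residue_le ?leq_addr.
have ly : (logn p (y (n + m)%N) < m)%N.
  rewrite ltnNge -pfactor_dvdn ?lt0n //.
  by rewrite /dvdn padic_residue_le ?leq_addl.
by rewrite -addnS leq_add // ltnW.
Qed.

HB.instance Definition _ := GRing.ComUnitRing_isIntegral.Build Zp padic_integral.

End PadicInt.

Definition padic (p : nat) (p_pr : prime p) : Type := {fraction padic_int p_pr}.

Section Padic.
Variables (p : nat) (p_pr : prime p).
Local Notation Qp := (padic p_pr).
Local Open Scope classical_set_scope.

HB.instance Definition _ := GRing.Field.on Qp.

Definition padic_of_int (w : padic_int p_pr) : Qp := FracField.tofrac w.

(* The ball z + p^n Z_p, that is, {x : |x - z|_p <= p^-n}. *)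
Definition padic_ball (z : Qp) (n : nat) : set Qp :=
  [set z + p%:R ^+ n * padic_of_int w | w in [set: padic_int p_pr]].

Definition padic_open (U : set Qp) : Prop :=
  forall z, U z -> exists n, padic_ball z n `<=` U.

Fact padic_openT : padic_open setT.
Proof. by move=> z _; exists 0%N. Qed.

Lemma padic_ball_le z m n : (m <= n)%N -> padic_ball z n `<=` padic_ball z m.
Proof.
move/subnKC <- => _ [w _ <-]; exists (p%:R ^+ (n - m) * w) => //.
by rewrite /padic_of_int rmorphM rmorphXn rmorph_nat /= exprD mulrA.
Qed.

Fact padic_openI : setI_closed padic_open.
Proof.
move=> U V oU oV z [/oU[m mU] /oV[n nV]]; exists (maxn m n) => x zx; split.
- by apply/mU/(padic_ball_le (leq_maxl m n)).
- by apply/nV/(padic_ball_le (leq_maxr m n)).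
Qed.

Fact padic_open_bigcup (I : Type) (f : I -> set Qp) :
  (forall i, padic_open (f i)) -> padic_open (\bigcup_i f i).
Proof.
move=> of_ z [i _ /of_[n nf]]; exists n => x /nf fx; by exists i.
Qed.

HB.instance Definition _ := isOpenTopological.Build Qp
  padic_openT padic_openI padic_open_bigcup.

Lemma padic_openE : open = padic_open.
Proof. by []. Qed.

End Padic.

Section Forms.
Import mpoly.
Variable r : nat.

Definition cubic_form (R : comNzRingType) (a : 'I_r -> 'I_r -> 'I_r -> R) :
    {mpoly R[r]} :=
  \sum_i \sum_j \sum_k a i j k *: ('X_i * 'X_j * 'X_k).

Definition primitive_coefs (a : 'I_r -> 'I_r -> 'I_r -> int) : Prop :=
  ~ exists d : int, 1 < d /\ forall i j k, (d %| a i j k)%Z.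

Section Order.
Variable K : fieldType.
Implicit Types C : {mpoly K[r]}.

(* The tuple substituted for the variables is the vector T x. *)
Definition form_equiv C1 C2 : Prop :=
  exists2 T : 'M[K]_r, T \in unitmx &
    C1 = C2 \mPo [tuple \sum_j T i j *: 'X_j | i < r].

Definition involves_only C (S : {set 'I_r}) : Prop :=
  forall m, m \in msupp C -> forall i, m i != 0%N -> i \in S.

Definition equiv_in_vars C (m : nat) : Prop :=
  exists (C' : {mpoly K[r]}) (S : {set 'I_r}),
    [/\ C' \is 3.-homog, form_equiv C C', #|S| = m & involves_only C' S].

Definition form_order C (m : nat) : Prop :=
  equiv_in_vars C m /\ forall m', equiv_in_vars C m' -> (m <= m')%N.

Definition nondegenerate_form C : Prop := form_order C r.

End Order.

Definition ratio_set (C : {mpoly int[r]}) : set rat :=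
  [set q | exists x y : 'I_r -> int,
     C.@[y] <> 0 /\ q = C.@[x]%:~R / C.@[y]%:~R]%classic.

Definition extend_scalars (K : nzRingType) (C : {mpoly int[r]}) : {mpoly K[r]} :=
  map_mpoly intr C.

End Forms.

(* Main.v *)
Require Import Defs.
From HB Require Import structures.
From mathcomp Require Import all_boot all_order all_algebra.
From mathcomp Require Import generic_quotient fraction finfield.
From mathcomp Require Import boolp classical_sets topology.
From mathcomp Require Import ring zify.

Set Implicit Arguments.
Unset Strict Implicit.
Unset Printing Implicit Defensive.

Import GRing.Theory Num.Theory.
Local Open Scope ring_scope.

(** Everything happens over the integers (Davenport's descent). If a cubic
    form [F] has a zero mod [p] that is nonsingular along some line, then
    Hensel's lemma shows that [F] takes values arbitrarily close to every
    element of [p Z_p], so the ratios of values are dense in [Q_p].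

    Otherwise every zero [e] of [F] mod [p] is singular, and even radical:
    [F(s e + y) = F(y)] mod [p], because a nonzero coefficient of [s] would let
    one solve for [s] and find a nonsingular zero. By Chevalley-Warning, [F]
    mod [p] is then an anisotropic form in at most 3 variables; hence
    [{x : p | F x}] is a lattice [Z^n T1] with [det T1 | p^3], and [F / p] is
    again an integral cubic form on it. Doing this three times gives [T] with
    [det T | p^9] and [F(x T) = p^3 F3(x)], where [Z^n T = {x : p^3 | F x}]
    contains [p Z^n]. So [T' T = p] for an integral [T'], hence [F = F3 o T'],
    and [p | det T'] since [n > 9]. Iterating, [F = Fk o T'k] with
    [p^k | det T'k]. But the matrix [M] of second polars of a nondegenerate
    form satisfies [M L = d] for an integral [L] and some [d <> 0], and
    [T'k] divides [M] on the left, so [p^k] divides [d^n] for all [k],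
    which is absurd. *)

(** * Cubic functions on Z^n *)

Section CubicFunctions.
Variable n : nat.
Local Notation V := 'rV[int]_n.
Implicit Types (f g h q F G : V -> int) (x y z e : V).

Definition lin f := forall a x y, f (a *: x + y) = a * f x + f y.

(** Here and in [cubic], finite sums of products of linear functions stand for integral forms: no
    coefficients are chosen, so closure under substitution and all identities follow by induction on
    the sum. *)
Inductive quad F : Prop :=
| quad_zero : (forall x, F x = 0) -> quad F
| quad_cons f g G : lin f -> lin g -> quad G ->
    (forall x, F x = f x * g x + G x) -> quad F.

Inductive cubic F : Prop :=
| cubic_zero : (forall x, F x = 0) -> cubic F
| cubic_cons f g h G : lin f -> lin g -> lin h -> cubic G ->
    (forall x, F x = f x * g x * h x + G x) -> cubic F.

Lemma linD f : lin f -> {morph f : x y / x + y}.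
Proof. by move=> lf x y; have := lf 1 x y; rewrite scale1r mul1r. Qed.

Lemma lin0 f : lin f -> f 0 = 0.
Proof. by move=> /linD /(_ 0 0); rewrite addr0 => H; lia. Qed.

Lemma linZ f a x : lin f -> f (a *: x) = a * f x.
Proof. by move=> lf; rewrite -[a *: x]addr0 lf lin0 // addr0. Qed.

Lemma lin_sum f (I : Type) (r : seq I) (c : I -> int) (v : I -> V) : lin f ->
  f (\sum_(i <- r) c i *: v i) = \sum_(i <- r) c i * f (v i).
Proof.
move=> lf; elim/big_rec2: _ => [|i y1 y2 _ <-]; first exact: lin0.
by rewrite lf.
Qed.

Lemma lin_coord i : lin (fun x : V => x 0 i).
Proof. by move=> a x y; rewrite !mxE. Qed.

Lemma lin_scale c f : lin f -> lin (fun x => c * f x).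
Proof. by move=> lf a x y; rewrite lf; ring. Qed.

Lemma lin_comp (T : 'M[int]_n) f : lin f -> lin (fun x => f (x *m T)).
Proof. by move=> lf a x y; rewrite mulmxDl -scalemxAl lf. Qed.

Lemma lin_add f g : lin f -> lin g -> lin (fun x => f x + g x).
Proof. by move=> lf lg a x y; rewrite lf lg; ring. Qed.

Lemma eq_quad F G : (forall x, F x = G x) -> quad F -> quad G.
Proof.
move=> FG [F0|f g H lf lg qH FE]; first by left=> x; rewrite -FG.
by apply: (quad_cons lf lg qH) => x; rewrite -FG.
Qed.

Lemma quad_add F G : quad F -> quad G -> quad (fun x => F x + G x).
Proof.
move=> qF qG; elim: {F}qF => [F F0|F f g H lf lg _ IH FE].
  by apply: eq_quad qG => x; rewrite F0 add0r.
by apply: (quad_cons lf lg IH) => x; rewrite FE addrA.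
Qed.

Lemma quad_lin f g : lin f -> lin g -> quad (fun x => f x * g x).
Proof.
move=> lf lg; apply: (@quad_cons _ f g (fun=> 0)) => //; first by left.
by move=> x; rewrite addr0.
Qed.

Lemma quad_scale c F : quad F -> quad (fun x => c * F x).
Proof.
elim=> {F} [F F0|F f g H lf lg _ IH FE].
  by left=> x; rewrite F0 mulr0.
by apply: (quad_cons (lin_scale c lf) lg IH) => x; rewrite FE; ring.
Qed.

Lemma quad_comp (T : 'M[int]_n) F : quad F -> quad (fun x => F (x *m T)).
Proof.
elim=> {F} [F F0|F f g H lf lg _ IH FE]; first by left=> x; rewrite F0.
by apply: (quad_cons (lin_comp T lf) (lin_comp T lg) IH) => x; rewrite FE.
Qed.

Lemma eq_cubic F G : (forall x, F x = G x) -> cubic F -> cubic G.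
Proof.
move=> FG [F0|f g h H lf lg lh qH FE]; first by left=> x; rewrite -FG.
by apply: (cubic_cons lf lg lh qH) => x; rewrite -FG.
Qed.

Lemma cubic_add F G : cubic F -> cubic G -> cubic (fun x => F x + G x).
Proof.
move=> qF qG; elim: {F}qF => [F F0|F f g h H lf lg lh _ IH FE].
  by apply: eq_cubic qG => x; rewrite F0 add0r.
by apply: (cubic_cons lf lg lh IH) => x; rewrite FE addrA.
Qed.

Lemma cubic_sum (I : Type) (r : seq I) (F : I -> V -> int) :
  (forall i, cubic (F i)) -> cubic (fun x => \sum_(i <- r) F i x).
Proof.
move=> cF; elim: r => [|i r IH]; first by left=> x; rewrite big_nil.
by apply: eq_cubic (cubic_add (cF i) IH) => x; rewrite big_cons.
Qed.

Lemma cubic_lin f g h :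
  lin f -> lin g -> lin h -> cubic (fun x => f x * g x * h x).
Proof.
move=> lf lg lh; apply: (@cubic_cons _ f g h (fun=> 0)) => //; first by left.
by move=> x; rewrite addr0.
Qed.

Lemma cubic_lin_quad f q : lin f -> quad q -> cubic (fun x => f x * q x).
Proof.
move=> lf; elim=> {q} [F F0|F g h H lg lh _ IH FE].
  by left=> x; rewrite F0 mulr0.
by apply: (cubic_cons lf lg lh IH) => x; rewrite FE; ring.
Qed.

Lemma cubic_scale c F : cubic F -> cubic (fun x => c * F x).
Proof.
elim=> {F} [F F0|F f g h H lf lg lh _ IH FE].
  by left=> x; rewrite F0 mulr0.
by apply: (cubic_cons (lin_scale c lf) lg lh IH) => x; rewrite FE; ring.
Qed.

Lemma cubic_comp (T : 'M[int]_n) F : cubic F -> cubic (fun x => F (x *m T)).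
Proof.
elim=> {F} [F F0|F f g h H lf lg lh _ IH FE]; first by left=> x; rewrite F0.
by apply: (cubic_cons (lin_comp T lf) (lin_comp T lg) (lin_comp T lh) IH) => x;
   rewrite FE.
Qed.

(** * Expansion along a line, divisibility by an integer, polarization *)

Lemma quad_expand Q e : quad Q -> exists2 L, lin L &
  forall s y, Q (s *: e + y) = s ^+ 2 * Q e + s * L y + Q y.
Proof.
elim=> {Q} [Q Q0|Q f g H lf lg _ [L lL LE] QE].
  by exists (fun=> 0) => [a x y|s y]; rewrite ?Q0; ring.
exists (fun y => f e * g y + g e * f y + L y).
  by do 2?apply: lin_add => //; apply: lin_scale.
by move=> s y; rewrite !QE lf lg LE; ring.
Qed.

Lemma cubic_expand F e : cubic F -> exists L Q, [/\ lin L, quad Q &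
  forall s y,
    F (s *: e + y) = s ^+ 3 * F e + s ^+ 2 * L y + s * Q y + F y].
Proof.
elim=> {F} [F F0|F f g h H lf lg lh _ [L [Q [lL qQ LE]]] FE].
  by exists (fun=> 0), (fun=> 0); split=> [a x y||s y];
     rewrite ?F0; [ring|by left|ring].
exists (fun y => (f e * g e) * h y + (g e * h e) * f y + (h e * f e) * g y + L y).
exists (fun y => f e * (g y * h y) + g e * (h y * f y) + h e * (f y * g y) + Q y).
split.
- by do 3?apply: lin_add => //; apply: lin_scale.
- by do 3?apply: quad_add => //; apply/quad_scale/quad_lin.
- by move=> s y; rewrite !FE lf lg lh LE; ring.
Qed.

Lemma quad0 F : quad F -> F 0 = 0.
Proof.
elim=> {F} [F F0|F f g H lf lg _ IH FE]; first exact: F0.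
by rewrite FE IH lin0 // mul0r.
Qed.

Lemma quadZ F s x : quad F -> F (s *: x) = s ^+ 2 * F x.
Proof.
elim=> {F} [F F0|F f g H lf lg _ IH FE]; first by rewrite !F0 mulr0.
by rewrite !FE IH !linZ //; ring.
Qed.

Lemma cubicZ F s x : cubic F -> F (s *: x) = s ^+ 3 * F x.
Proof.
elim=> {F} [F F0|F f g h H lf lg lh _ IH FE]; first by rewrite !F0 mulr0.
by rewrite !FE IH !linZ //; ring.
Qed.

Lemma dvdz_addr_id (d u v : int) : (d %| u)%Z -> (d %| u + v)%Z = (d %| v)%Z.
Proof. by move=> du; rewrite (rpredDl _ du). Qed.

Lemma cubic_dvd_cong F (p : int) x z : cubic F ->
  (p %| F (p *: z + x))%Z = (p %| F x)%Z.
Proof.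
move=> /(cubic_expand z)[L [Q [_ _ ->]]]; apply: dvdz_addr_id.
by apply/dvdzP; exists (p ^+ 2 * F z + p * L x + Q x); ring.
Qed.

Lemma lin_divisible (p : int) f : p != 0 -> lin f ->
  (forall x, p %| f x)%Z -> exists2 g, lin g & forall x, f x = p * g x.
Proof.
move=> p0 lf pf; have fE x : f x = p * (f x %/ p)%Z by rewrite mulrC divzK.
exists (fun x => (f x %/ p)%Z) => // a x y.
by apply: (mulfI p0); rewrite -fE lf {1}fE {1}[f y]fE; ring.
Qed.

Definition proj (S : {set 'I_n}) : 'M[int]_n := diag_mx (\row_i (i \in S)%:R).

Lemma proj_coord (S : {set 'I_n}) x i :
  (x *m proj S) 0 i = if i \in S then x 0 i else 0.
Proof. by rewrite mul_mx_diag !mxE; case: ifP; rewrite ?mulr1 ?mulr0. Qed.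

(** The summands of [Q] need not be divisible by [p], so [R] is built one coordinate at a time: the
    coordinate along [e] contributes [x_k^2 Q(e) + x_k L(y)], and both [Q(e)] and
    [L(y) = Q(e + y) - Q(e) - Q(y)] are divisible by [p]. Nothing is halved, so [p = 2] is
    covered. *)
Lemma quad_divisible (p : int) Q : p != 0 -> quad Q ->
  (forall x, p %| Q x)%Z -> exists2 R, quad R & forall x, Q x = p * R x.
Proof.
move=> p0 qQ pQ; pose P k := proj [set i : 'I_n | (i < k)%N].
have QP k : exists2 R, quad R & forall x, Q (x *m P k) = p * R x.
  elim: k => [|k [R qR RE]].
    exists (fun=> 0); first by left.
    move=> x; suff -> : x *m P 0%N = 0.
      by rewrite quad0 // mulr0.
    by apply/rowP => i; rewrite proj_coord inE mxE.
  have [kn|nk] := ltnP k n; last first.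
    exists R => // x; rewrite -RE; congr Q; apply/rowP => i.
    by rewrite !proj_coord !inE; congr (if _ then _ else _); have := ltn_ord i; lia.
  pose e : V := delta_mx 0 (Ordinal kn).
  have [L lL LE] := quad_expand e qQ.
  have pL y : (p %| L y)%Z.
    have -> : L y = Q (1 *: e + y) - Q e - Q y by rewrite LE; ring.
    by rewrite !rpredB.
  have [L' lL' L'E] := lin_divisible p0 lL pL.
  have /dvdzP[c cE] := pQ e.
  exists (fun x => c * (x 0 (Ordinal kn) * x 0 (Ordinal kn)) +
                  x 0 (Ordinal kn) * L' (x *m P k) + R x).
    apply: quad_add => //; apply: quad_add.
      by apply/quad_scale/quad_lin; apply: lin_coord.
    by apply: quad_lin; [apply: lin_coord|apply: lin_comp].
  move=> x; have -> : x *m P k.+1 = x 0 (Ordinal kn) *: e + x *m P k.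
    apply/rowP => i; rewrite proj_coord [RHS]mxE [X in _ + X]proj_coord [X in X + _]mxE.
    rewrite [delta_mx _ _ _ _]mxE !inE eqxx /=.
    rewrite -val_eqE /= ltnS leq_eqVlt.
    by have [ik|_] := eqVneq (i : nat) k;
      rewrite ?ik ?ltnn ?mulr1 ?mulr0 ?addr0 ?add0r //=;
      congr (x _ _); apply: val_inj.
  by rewrite LE L'E cE RE; ring.
have [R qR RE] := QP n; exists R => // x; rewrite -RE; congr Q.
by apply/rowP => i; rewrite proj_coord inE ltn_ord.
Qed.

(** Inclusion-exclusion isolates the trilinear part: for cubic [F] this is the symmetric trilinear
    form with [pol F x x x = 6 * F x]. *)
Definition pol F x y z :=
  F (x + y + z) - F (x + y) - F (x + z) - F (y + z) + F x + F y + F z.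

Lemma lin_pol F y z : cubic F -> lin (fun x => pol F x y z).
Proof.
elim=> {F} [F F0|F f g h H lf lg lh _ IH FE] a x x'.
  by rewrite /pol !F0; ring.
have := IH a x x'; rewrite /pol !FE.
rewrite -!addrA !lf !lg !lh !(linD lf) !(linD lg) !(linD lh) => IHx.
apply/eqP; rewrite -subr_eq0; apply/eqP.
move/eqP: IHx; rewrite -subr_eq0 => /eqP <-; ring.
Qed.

End CubicFunctions.

(** * Chevalley-Warning over F_p *)

(** The substitution [a -> b * a] multiplies the sum by [b ^ e], so it vanishes as soon as some
    nonzero [b] has [b ^ e != 1]. For [e = 0] the sum is [p] times 1. *)
Lemma sum_expr_Fp p e : prime p -> (e < p.-1)%N -> \sum_(a : 'F_p) a ^+ e = 0.
Proof.
move=> p_pr ep; have p1 := prime_gt1 p_pr; case: e => [|e] in ep *.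
  by under eq_bigr do rewrite expr0; rewrite sumr_const card_Fp // pchar_Fp_0.
(* Otherwise [X^(e+1) - 1] would have [p - 1] roots, more than its degree. *)
have [b b0 be] : exists2 b : 'F_p, b != 0 & b ^+ e.+1 != 1.
  apply: contrapT => H; pose s := enum [set~ 0 : 'F_p].
  have := @max_poly_roots _ ('X^(e.+1) - 1) s.
  rewrite -size_poly_eq0 size_XnsubC // enum_uniq -cardE cardsC1 card_Fp // => /(_ isT).
  suff Hr : all (root ('X^(e.+1) - 1)) s by move=> /(_ Hr isT); lia.
  apply/allP => b; rewrite mem_enum !inE => b0; apply/negPn/negP => rb.
  case: H; exists b => //; apply: contra rb => /eqP be.
  by rewrite /root !hornerE be subrr.
have: b ^+ e.+1 * \sum_(a : 'F_p) a ^+ e.+1 = \sum_(a : 'F_p) a ^+ e.+1.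
  rewrite [RHS](reindex_onto ( *%R b) ( *%R b^-1)) => [|a _]; last by rewrite mulVKf.
  rewrite mulr_sumr; apply: eq_big => [a|a _]; first by rewrite mulKf ?eqxx.
  by rewrite exprMn.
move/eqP; rewrite -subr_eq0 -{2}[\sum_a _]mul1r -mulrBl mulf_eq0 subr_eq0.
by rewrite (negPf be) => /eqP.
Qed.

Section ChevalleyWarning.
Import mpoly.
Variables (p : nat) (p_pr : prime p).

(** A monomial of degree below [n (p - 1)] has some exponent below [p - 1], and the power sum over
    that variable vanishes. *)
Lemma sum_homog_Fp n d (q : {mpoly 'F_p[n]}) : (d < n * p.-1)%N ->
  q \is d.-homog -> \sum_(x : {ffun 'I_n -> 'F_p}) q.@[x] = 0.
Proof.
move=> dn /dhomogP hq; under eq_bigr do rewrite mevalE.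
rewrite exchange_big big_seq big1 // => m /hq /= md.
rewrite -mulr_sumr -(bigA_distr_bigA (fun i a => a ^+ m i)) /=.
suff [i mi] : exists i, (m i < p.-1)%N.
  by rewrite (bigD1 i) //= sum_expr_Fp // mul0r mulr0.
apply/not_existsP => H; move: dn; rewrite -md mdegE ltnNge => /negP[].
rewrite -[X in (X * _)%N]card_ord -sum_nat_const; apply: leq_sum => i _.
by rewrite leqNgt; apply/negP/H.
Qed.

(** [P ^ (p - 1)] is 1 wherever [P] does not vanish. If 0 were the only zero, its values would add
    up to [p ^ n - 1 = -1], whereas its degree [d (p - 1)] forces the sum to be 0. *)
Lemma Chevalley_Warning_Fp n d (P : {mpoly 'F_p[n]}) : (0 < d < n)%N ->
  P \is d.-homog -> exists2 x : {ffun 'I_n -> 'F_p}, x != 0 & P.@[x] = 0.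
Proof.
case/andP=> d0 dn hP; have p1 := prime_gt1 p_pr.
have n0 : (0 < n)%N by lia.
have P0 : P.@[(0 : {ffun 'I_n -> 'F_p})] = 0.
  rewrite mevalE big_seq big1 // => m /(dhomogP _ _ _ hP) /= md.
  suff [i mi] : exists i, m i != 0%N.
    by rewrite (bigD1 i) //= ffunE expr0n (negPf mi) mul0r mulr0.
  apply/not_existsP => H; move: d0; rewrite -md mdegE big1 // => i _.
  by have /negP := H i; rewrite negbK => /eqP.
apply: contrapT => H.
have hPX : P ^+ p.-1 \is (d * p.-1).-homog.
  elim: (p.-1) => [|k IH]; first by rewrite expr0 muln0 dhomog1.
  by rewrite exprS mulnS dhomogM.
have dp : (d * p.-1 < n * p.-1)%N by rewrite ltn_mul2r dn andbT; lia.
have /eqP := sum_homog_Fp dp hPX.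
rewrite (bigD1 (0 : {ffun 'I_n -> 'F_p})) //= rmorphXn /= P0 expr0n.
have -> : (p.-1 == 0)%N = false by lia.
rewrite add0r (eq_bigr (fun=> 1)) => [|x x0].
  rewrite sumr_const -[X in _ *+ X]/#|predC1 _|.
  have -> : #|predC1 (0 : {ffun 'I_n -> 'F_p})| = (p ^ n).-1.
    by rewrite cardC1 card_ffun card_Fp // card_ord.
  rewrite -(inj_eq (addIr 1)) add0r -[X in _ + X]/(1%:R) -natrD addn1.
  rewrite prednK ?expn_gt0 ?prime_gt0 //.
  by rewrite natrX pchar_Fp_0 // expr0n gtn_eqF // eq_sym oner_eq0.
rewrite rmorphXn /=.
have Px : P.@[x] != 0 by apply/eqP => Px; apply: H; exists x.
apply: (mulfI Px); rewrite -exprS prednK ?prime_gt0 // mulr1.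
by rewrite -{2}[P.@[x]]expf_card card_Fp.
Qed.

End ChevalleyWarning.

(** * Reduction modulo p *)

Section ResidueForm.
Import mpoly.

(** Turns a cubic function on the span of the [v i] into a polynomial over [R], to which
    Chevalley-Warning applies when [R] is [F_p]. *)
Lemma cubic_mpoly (R : comNzRingType) n m (F : 'rV[int]_n -> int)
    (v : 'I_m -> 'rV[int]_n) : cubic F ->
  exists2 P : {mpoly R[m]}, P \is 3.-homog &
    forall y : 'I_m -> int,
      (F (\sum_i y i *: v i))%:~R = P.@[fun i => (y i)%:~R].
Proof.
pose l f : {mpoly R[m]} := \sum_i (f (v i))%:~R *: 'X_i.
have lh f : l f \is 1.-homog.
  by apply: rpred_sum => i _; rewrite rpredZ // dhomogX /= mdeg1.
have lE f y : lin f -> (f (\sum_i y i *: v i))%:~R = (l f).@[fun i => (y i)%:~R].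
  move=> lf; rewrite lin_sum // rmorph_sum /l raddf_sum /=; apply: eq_bigr => i _.
  by rewrite mevalZ mevalXU rmorphM mulrC.
elim=> {F} [F F0|F f g h G lf lg lh' _ [P hP PE] FE].
  by exists 0 => [|y]; rewrite ?rpred0 // F0 meval0.
exists (l f * l g * l h + P).
  by rewrite rpredD // (@dhomogM _ _ _ 2) // (@dhomogM _ _ _ 1).
by move=> y; rewrite FE !rmorphD !rmorphM /= PE !lE.
Qed.

End ResidueForm.

Section ReductionModP.
Variables (p : nat) (p_pr : prime p) (n : nat).
Local Notation V := 'rV[int]_n.
Local Notation P := (p%:Z).
Implicit Types (F G : V -> int) (x y e : V) (S : {set 'I_n}).

Lemma Posz_prime_neq0 : P != 0.
Proof. by have := prime_gt0 p_pr; lia. Qed.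

Lemma prime_inv_mod (a : int) : ~~ (P %| a)%Z ->
  exists b c : int, b * a = 1 + c * P.
Proof.
move=> pa; have [u [v uv]] := Bezoutz a P.
have cop : gcdz a P = 1.
  rewrite /gcdz gcdnC; congr Posz; apply/eqP.
  by rewrite -[_ == _]/(coprime p `|a|) prime_coprime.
by exists u, (- v); rewrite cop in uv; rewrite -uv; ring.
Qed.

(** Restricted to the coordinates in [S], [F] has degree 3 and more than 3 variables; the zero given
    by Chevalley-Warning is lifted to integers. *)
Lemma cubic_zero_modp F S : cubic F -> (3 < #|S|)%N ->
  exists e, [/\ e *m proj S = e, exists i, ~~ (P %| (e 0 i)%R)%Z & (P %| F e)%Z].
Proof.
move=> cF S3; pose k i : 'I_n := enum_val (widen_ord S3 i).
have k_inj : injective k by move=> i j /enum_val_inj /(congr1 val) /= /val_inj.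
have [Q hQ QE] := cubic_mpoly 'F_p (fun i => delta_mx 0 (k i) : V) cF.
have [//|x x0 Qx] := Chevalley_Warning_Fp p_pr _ hQ.
have charp : p \in [pchar 'F_p] by apply: pchar_Fp.
pose t i : int := (x i : nat)%:Z.
have tE i : (t i)%:~R = x i by rewrite /t -pmulrn natr_Zp.
exists (\sum_i t i *: delta_mx 0 (k i)); split.
- apply/rowP => j; rewrite proj_coord summxE; case: ifP => // jS.
  rewrite big1 // => i _; rewrite !mxE eqxx /=.
  have [ji|] := eqVneq j (k i); last by rewrite mulr0.
  by move: jS; rewrite ji enum_valP.
- have [i xi] : exists i, x i != 0.
    apply: contrapT => H; case/eqP: x0; apply/ffunP => i; rewrite ffunE.
    by apply/eqP/negPn/negP => xi; apply: H; exists i.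
  exists (k i); rewrite summxE (bigD1 i) //= big1 => [|j ji].
    by rewrite addr0 !mxE !eqxx mulr1 (dvdz_pcharf charp) tE.
  by rewrite !mxE (inj_eq k_inj) [i == j]eq_sym (negPf ji) andbF mulr0.
- rewrite (dvdz_pcharf charp) QE -Qx; apply/eqP.
  by apply: mpoly.meval_eq => i; rewrite tE.
Qed.

(* [b] is the derivative of [F] at [e] in the direction [d]. *)
Definition smooth_zero_modp F := exists e d a b c c',
  [/\ forall s, F (e + s *: d) = a + b * s + c * s ^+ 2 + c' * s ^+ 3,
      (P %| a)%Z & ~~ (P %| b)%Z].

Lemma smooth_zero_comp F (T : 'M[int]_n) :
  smooth_zero_modp (fun x => F (x *m T)) -> smooth_zero_modp F.
Proof.
move=> [e [d [a [b [c [c' [FE pa pb]]]]]]].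
exists (e *m T), (d *m T), a, b, c, c'; split=> // s.
by rewrite -FE mulmxDl -scalemxAl.
Qed.

Lemma singular_zero_radical F e : cubic F -> ~ smooth_zero_modp F ->
  (P %| F e)%Z -> exists c L Q, [/\ lin L, quad Q &
  forall s y,
    F (s *: e + y) = F y + P * (s ^+ 3 * c + s ^+ 2 * L y + s * Q y)].
Proof.
move=> cF nF pe; have [L [Q [lL qQ FE]]] := cubic_expand e cF.
have pL y : (P %| L y)%Z.
  (* [e] is a zero mod [p], and [L y] is the derivative of [F] there along [y]. *)
  apply/negPn/negP => pL; apply: nF; exists e, y, (F e), (L y), (Q y), (F y).
  split=> // s; rewrite -[e in LHS]scale1r FE linZ // quadZ // cubicZ //; ring.
have pQ y : (P %| Q y)%Z.
  apply/negPn/negP => pQ; apply: nF.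
  (* Modulo [p] only [s * Q y + F y] is left of [F (s *: e + y)]; [s0] is its root, and there the
     derivative along [e] is [Q y]. *)
  have [b [c bc]] := prime_inv_mod pQ; pose s0 := - b * F y.
  pose C1 := s0 ^+ 3 * F e + s0 ^+ 2 * L y.
  exists (s0 *: e + y), e, (C1 + s0 * Q y + F y),
    (3 * s0 ^+ 2 * F e + 2 * s0 * L y + Q y), (3 * s0 * F e + L y), (F e).
  split=> [s||].
  - rewrite addrAC -scalerDl FE /C1; ring.
  - have -> : C1 + s0 * Q y + F y = C1 + P * (- c * F y).
      rewrite -addrA; congr (_ + _).
      by rewrite /s0 -mulrA [F y * _]mulrC mulrA mulNr bc; ring.
    by rewrite rpredD ?dvdz_mulr // rpredD ?dvdz_mull.
  - by rewrite dvdz_addr_id // rpredD ?dvdz_mull.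
have [L' lL' L'E] := lin_divisible Posz_prime_neq0 lL pL.
have [Q' qQ' Q'E] := quad_divisible Posz_prime_neq0 qQ pQ.
have /dvdzP[c cE] := pe.
by exists c, L', Q'; split=> // s y; rewrite FE L'E Q'E cE; ring.
Qed.

(** In a basis where [e] replaces the basis vector [i0], the coordinate [i0] multiplies a radical
    vector, so it drops out of [F] modulo [p]. *)
Lemma eliminate_variable F e i0 : cubic F -> ~ smooth_zero_modp F ->
  (P %| F e)%Z -> e 0 i0 = 1 ->
  exists U U' G, [/\ U' *m U = 1%:M, cubic G,
    forall x, x 0 i0 = 0 -> x *m U = x &
    forall x, F (x *m U) = F (x *m proj (~: [set i0])) + P * G x].
Proof.
move=> cF nF pe e1; have [c [L [Q [lL qQ FE]]]] := singular_zero_radical cF nF pe.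
pose w := e - delta_mx 0 i0; pose d : 'cV[int]_n := delta_mx i0 0.
have wd : w *m d = 0.
  by apply/rowP => j; rewrite -colE !mxE e1 !eqxx subrr.
have xd x : x *m (d *m w) = x 0 i0 *: w.
  rewrite mulmxA -colE; apply/rowP => j.
  by rewrite !mxE big_ord1 !mxE.
have dd : (d *m w) *m (d *m w) = 0 by rewrite mulmxA -(mulmxA d) wd mulmx0 mul0mx.
pose pr := proj (~: [set i0]).
(* [U] is the identity with row [i0] replaced by [e]; [d *m w] squares to 0 as [e] has coordinate 1
   at [i0], hence the integral inverse. *)
exists (1%:M + d *m w), (1%:M - d *m w),
  (fun x => c * (x 0 i0 * x 0 i0 * x 0 i0) + x 0 i0 * x 0 i0 * L (x *m pr)
     + x 0 i0 * Q (x *m pr)); split.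
- move: dd; move: (d *m w) => N dd.
  by rewrite mulmxBl mul1mx mulmxDr mulmx1 dd addr0 addrK.
- apply: cubic_add; first apply: cubic_add.
  + by apply/cubic_scale/cubic_lin; apply: lin_coord.
  + by apply: cubic_lin; [apply: lin_coord|apply: lin_coord|apply: lin_comp].
  + by apply: cubic_lin_quad; [apply: lin_coord|apply: quad_comp].
- by move=> x x0; rewrite mulmxDr mulmx1 xd x0 scale0r addr0.
- move=> x; have -> : x *m (1%:M + d *m w) = x 0 i0 *: e + x *m pr.
    rewrite mulmxDr mulmx1 xd; apply/rowP => j.
    rewrite [RHS]mxE [in RHS]proj_coord !mxE !inE eqxx /=.
    by have [->|_] := eqVneq j i0; rewrite ?e1 /=; ring.
  by rewrite FE; congr (_ + _ * _); ring.
Qed.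

(** Each nontrivial zero mod [p] supported on [S] removes one index from [S]; the process stops when
    the form in the remaining variables is anisotropic mod [p]. *)
Lemma anisotropic_reduction F : cubic F -> ~ smooth_zero_modp F ->
  exists U U' S G, [/\ U' *m U = 1%:M, cubic G,
    forall x, F (x *m U) = F (x *m proj S *m U) + P * G x &
    forall e, e *m proj S = e -> (P %| F (e *m U))%Z -> forall i, (P %| (e 0 i)%R)%Z].
Proof.
move=> cF nF.
suff H k : forall U U' S G, (#|S| <= k)%N ->
    U' *m U = 1%:M -> cubic G ->
    (forall x, F (x *m U) = F (x *m proj S *m U) + P * G x) ->
  exists U U' S G, [/\ U' *m U = 1%:M, cubic G,
    forall x, F (x *m U) = F (x *m proj S *m U) + P * G x &
    forall e, e *m proj S = e -> (P %| F (e *m U))%Z -> forall i, (P %| (e 0 i)%R)%Z].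
  apply: (H n 1%:M 1%:M finset.setT (fun=> 0)); rewrite ?mulmx1 //.
  - by rewrite -[X in (_ <= X)%N]card_ord max_card.
  - by left.
  move=> x; rewrite mulr0 addr0; congr F; rewrite !mulmx1.
  by apply/rowP => i; rewrite proj_coord inE.
elim: k => [|k IH] U U' S G Sk U'U cG FE.
  exists U, U', S, G; split=> // e eS _ i.
  move: Sk; rewrite leqn0 cards_eq0 => /eqP S0.
  by rewrite -eS proj_coord S0 inE dvdz0.
case: (pselect (forall e, e *m proj S = e -> (P %| F (e *m U))%Z ->
   forall i, (P %| (e 0 i)%R)%Z)) => [aS|]; first by exists U, U', S, G.
case/existsNP => e /not_implyP[eS] /not_implyP[pe] /existsNP[i0 /negP pi].
have i0S : i0 \in S.
  by move: pi; rewrite -eS proj_coord; case: ifP; rewrite ?dvdz0.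
have [b [c bc]] := prime_inv_mod pi.
(* A unit multiple of [e] mod [p], corrected by a multiple of [p] so that its coordinate at [i0] is
   exactly 1. *)
pose e1 := P *: (- c *: delta_mx 0 i0) + b *: e.
have cFU := cubic_comp U cF.
have [|||U1 [U1' [G1 [U1'U1 cG1 U1x GE]]]] := @eliminate_variable _ e1 i0 cFU.
- by move=> /smooth_zero_comp.
- rewrite (cubic_dvd_cong _ _ _ cFU) /= -scalemxAl cubicZ //.
  by rewrite dvdz_mull.
- by rewrite !mxE !eqxx bc /=; ring.
have pS : proj (S :\ i0) = proj (~: [set i0]) *m proj S.
  rewrite /proj mulmx_diag; congr diag_mx; apply/rowP => j; rewrite !mxE !inE.
  by case: eqP; case: (j \in S); rewrite ?mulr1 ?mulr0.
apply: (IH (U1 *m U) (U' *m U1') (S :\ i0)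
  (fun x => G (x *m proj (~: [set i0])) + G1 x)).
- by move: Sk; rewrite (cardsD1 i0) i0S.
- by rewrite mulmxA -(mulmxA U') U1'U1 mulmx1.
- by apply: cubic_add => //; apply: cubic_comp.
move=> x; rewrite mulmxA GE FE mulmxA U1x; last by rewrite proj_coord !inE eqxx.
by rewrite pS mulmxA; ring.
Qed.

Lemma descent_step F : cubic F -> ~ smooth_zero_modp F ->
  exists T F1, [/\ cubic F1, (\det T %| P ^+ 3)%Z,
    forall x, F (x *m T) = P * F1 x &
    forall x, (P %| F x)%Z -> exists y, x = y *m T].
Proof.
move=> cF nF.
have [U [U' [S [G [U'U cG FE aS]]]]] := anisotropic_reduction cF nF.
have S3 : (#|S| <= 3)%N.
  rewrite leqNgt; apply/negP => S3.
  have [e [eS [i /negP pi] pe]] := cubic_zero_modp (cubic_comp U cF) S3.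
  by apply/pi/(aS e).
(* By anisotropy [p] divides [F (y *m U)] exactly when it divides the coordinates of [y] in [S], so
   the rows of [D *m U] span that lattice; as [det U] is a unit, the determinant divides
   [p ^ #|S|]. *)
pose D : 'M[int]_n := diag_mx (\row_i (if i \in S then P else 1)).
have DE x i : (x *m D) 0 i = if i \in S then P * x 0 i else x 0 i.
  by rewrite mul_mx_diag !mxE; case: ifP => _; ring.
exists (D *m U), (fun x => P ^+ 2 * F (x *m proj S *m U) + G (x *m D)); split.
- apply: cubic_add; last exact: cubic_comp.
  apply: cubic_scale; apply: eq_cubic (cubic_comp (proj S *m U) cF) => x.
  by rewrite mulmxA.
- rewrite det_mulmx mulrC (dvdz_trans (n := \det D)) //.
    by apply/dvdzP; exists (\det U'); rewrite mulrA -det_mulmx U'U det1 mul1r.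
  rewrite det_diag (eq_bigr (fun i => if i \in S then P else 1)) => [|i _].
    by rewrite -big_mkcond /= prodr_const dvdz_exp2l.
  by rewrite mxE.
- move=> x; rewrite mulmxA FE.
  have -> : x *m D *m proj S *m U = P *: (x *m proj S *m U).
    rewrite scalemxAl; congr (_ *m _); apply/rowP => i.
    by rewrite [RHS]mxE !proj_coord DE; case: (i \in S); rewrite ?mulr0.
  by rewrite cubicZ //; ring.
- move=> x px; pose y := x *m U'.
  have xE : x = y *m U by rewrite /y -mulmxA U'U mulmx1.
  have pyS : (P %| F (y *m proj S *m U))%Z.
    by move: px; rewrite xE FE addrC dvdz_addr_id // dvdz_mulr.
  have py i : i \in S -> (P %| (y 0 i)%R)%Z.
    move=> iS; have := aS (y *m proj S) _ pyS i; rewrite proj_coord iS; apply.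
    by apply/rowP => j; rewrite !proj_coord; case: (j \in S).
  exists (\row_i (if i \in S then ((y 0 i)%R %/ P)%Z else y 0 i)).
  rewrite mulmxA xE; congr (_ *m _); apply/rowP => i; rewrite DE [(\row_j _) 0 i]mxE.
  by case: (boolP (i \in S)) => // iS; rewrite mulrC divzK // py.
Qed.

(** The last hypothesis covers every form reached from [F] by an integral substitution and a
    division, hence also the two intermediate forms. *)
Lemma descent_three_steps F : (9 < n)%N -> cubic F ->
  (forall T q F1, q != 0 -> cubic F1 ->
     (forall x, F (x *m T) = q * F1 x) -> ~ smooth_zero_modp F1) ->
  exists T T' F1, [/\ cubic F1, (P %| \det T')%Z,
    forall x, F (x *m T) = P ^+ 3 * F1 x & forall x, F x = F1 (x *m T')].
Proof.
move=> n9 cF nF; have P0 := Posz_prime_neq0.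
have [|T1 [F1 [cF1 d1 E1 L1]]] := descent_step cF.
  by apply: (nF 1%:M 1) => // x; rewrite mulmx1 mul1r.
have [|T2 [F2 [cF2 d2 E2 L2]]] := descent_step cF1.
  by apply: (nF T1 P) => // x.
have [|T3 [F3 [cF3 d3 E3 L3]]] := descent_step cF2.
  apply: (nF (T2 *m T1) (P ^+ 2)) => // [|x]; first by rewrite expf_neq0.
  by rewrite mulmxA E1 E2; ring.
have FT x : F (x *m (T3 *m T2 *m T1)) = P ^+ 3 * F3 x.
  by rewrite !mulmxA E1 E2 E3; ring.
(* [F (P *: x)] carries the factor [P ^ 3]; each of the three lattices uses up one [P]. *)
have sub x : exists y, P *: x = y *m (T3 *m T2 *m T1).
  have [|y1 y1E] := L1 (P *: x); first by rewrite cubicZ // exprS -mulrA dvdz_mulr.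
  have F1y : F1 y1 = P ^+ 2 * F x.
    by apply: (mulfI P0); rewrite -E1 -y1E cubicZ //; ring.
  have [|y2 y2E] := L2 y1; first by rewrite F1y exprS -mulrA dvdz_mulr.
  have F2y : F2 y2 = P * F x.
    by apply: (mulfI P0); rewrite -E2 -y2E F1y; ring.
  have [|y3 y3E] := L3 y2; first by rewrite F2y dvdz_mulr.
  by exists y3; rewrite y1E y2E y3E !mulmxA.
have [f fE] := choice (fun i => sub (delta_mx 0 i)).
pose T' := \matrix_i f i.
have T'T : T' *m (T3 *m T2 *m T1) = P%:M.
  apply/row_matrixP => i; rewrite row_mul rowK -fE.
  by rewrite rowE scalar_mxC mul_scalar_mx.
exists (T3 *m T2 *m T1), T', F3; split=> //.
- have : (P ^+ n %| \det T' * P ^+ 9)%Z.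
    rewrite -(@det_scalar _ n P) -T'T det_mulmx dvdz_mul //.
    by rewrite !det_mulmx [P ^+ 9](exprD P 6 3) dvdz_mul // [P ^+ 6](exprD P 3 3) dvdz_mul.
  have -> : P ^+ n = P ^+ (n - 10) * P * P ^+ 9.
    by rewrite -exprSr -exprD; congr (_ ^+ _); lia.
  rewrite dvdz_mul2r ?expf_neq0 //.
  by apply: dvdz_trans; apply: dvdz_mull.
- move=> x; apply: (mulfI (expf_neq0 3 P0)); rewrite -FT -mulmxA T'T.
  by rewrite scalar_mxC mul_scalar_mx cubicZ.
Qed.

End ReductionModP.

(** * Polarization and descent *)

Lemma clear_denominators m n (A : 'M[rat]_(m, n)) :
  exists2 d : int, d != 0 & exists B : 'M[int]_(m, n),
    d%:~R *: A = map_mx intr B.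
Proof.
pose d : int := \prod_i \prod_j denq (A i j).
exists d; first by apply/prodf_neq0 => i _; apply/prodf_neq0 => j _; apply: denq_neq0.
exists (\matrix_(i, j) numq (d%:~R * A i j)); apply/matrixP => i j; rewrite !mxE.
have /dvdzP[c dE] : (denq (A i j) %| d)%Z.
  by rewrite /d (bigD1 i) //= (bigD1 j) //= -mulrA dvdz_mulr.
have -> : d%:~R * A i j = (c * numq (A i j))%:~R.
  by rewrite dE !rmorphM /= numqE; ring.
by rewrite numq_int.
Qed.

Section Polarization.
Variable n : nat.
Local Notation V := 'rV[int]_n.
Implicit Types (F G : V -> int).

(** The polarization tensor flattened along its first index. [T] enters the last two slots only, so
    that a substitution in [F] becomes a left factor of this matrix. *)
Definition pol_mx F (T : 'M[int]_n) : 'M[int]_(n, n * n) :=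
  \matrix_i mxvec (\matrix_(j, k)
    pol F (delta_mx 0 i) (delta_mx 0 j *m T) (delta_mx 0 k *m T)).

Lemma pol_mxE F T i j k : pol_mx F T i (mxvec_index j k) =
  pol F (delta_mx 0 i) (delta_mx 0 j *m T) (delta_mx 0 k *m T).
Proof. by rewrite !mxE mxvecE mxE. Qed.

Lemma pol_mx_comp F G (T : 'M[int]_n) : cubic G ->
  (forall x, F x = G (x *m T)) -> pol_mx F 1%:M = T *m pol_mx G T.
Proof.
move=> cG FE; apply/matrixP => i c; case/mxvec_indexP: c => j k.
rewrite pol_mxE !mulmx1 mxE; under eq_bigr do rewrite pol_mxE.
have -> : pol F (delta_mx 0 i) (delta_mx 0 j) (delta_mx 0 k) =
    pol G (delta_mx 0 i *m T) (delta_mx 0 j *m T) (delta_mx 0 k *m T).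
  by rewrite /pol !FE !mulmxDl.
rewrite -[delta_mx 0 i *m T]rowE [row i T]row_sum_delta.
rewrite (lin_sum _ _ _ (lin_pol _ _ cG)).
by apply: eq_bigr => l _; rewrite mxE.
Qed.

(** The row rank over the rationals decides: a kernel vector or a right inverse exists there, and
    denominators are cleared. *)
Lemma pol_mx_kernel_or_inverse F :
  (exists2 e : V, e != 0 & e *m pol_mx F 1%:M = 0) \/
  (exists2 d : int, d != 0 & exists L, pol_mx F 1%:M *m L = d%:M).
Proof.
pose M : 'M[rat]_(n, n * n) := map_mx intr (pol_mx F 1%:M).
have intr_inj_mx a b : injective (map_mx (intr : int -> rat) : 'M_(a, b) -> 'M_(a, b)).
  move=> A B /matrixP AB; apply/matrixP => i j.
  by have := AB i j; rewrite !mxE => /intr_inj.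
have [/row_freeP[L ML]|nM] := boolP (row_free M); [right|left].
  have [d d0 [B dB]] := clear_denominators L; exists d => //; exists B.
  apply: intr_inj_mx; rewrite map_mxM /= -dB -scalemxAr [map_mx _ _ *m L]ML.
  by rewrite map_scalar_mx scalemx1.
move: nM; rewrite -kermx_eq0 => /eqP k0.
have [i ki] : exists i, row i (kermx M) != 0.
  apply: contrapT => H; apply: k0; apply/row_matrixP => i; rewrite row0.
  by apply/eqP/negPn/negP => ki; apply: H; exists i.
have [d d0 [B dB]] := clear_denominators (row i (kermx M)); exists B.
  apply: contra ki => /eqP B0; move: dB; rewrite B0 map_mx0 => /eqP.
  by rewrite scaler_eq0 intr_eq0 (negPf d0).
apply: intr_inj_mx; rewrite map_mxM /= -dB map_mx0 -scalemxAl -row_mul.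
by rewrite mulmx_ker row0 scaler0.
Qed.

End Polarization.

(** * Iterated descent, bounded by a determinant *)

Section Descent.
Variables (p : nat) (p_pr : prime p) (n : nat).
Local Notation V := 'rV[int]_n.
Local Notation P := (p%:Z).
Implicit Types (F : V -> int).

(** [T] and [q] tie [F1] back to [F], which keeps the hypothesis available for the next round; [T']
    collects the powers of [P]. *)
Lemma descent_iterate F k : (9 < n)%N -> cubic F ->
  (forall T q F1, q != 0 -> cubic F1 ->
     (forall x, F (x *m T) = q * F1 x) -> ~ smooth_zero_modp p F1) ->
  exists T T' q F1, [/\ q != 0, cubic F1, (P ^+ k %| \det T')%Z,
    forall x, F (x *m T) = q * F1 x & forall x, F x = F1 (x *m T')].
Proof.
move=> n9 cF nF; elim: k => [|k [T [T' [q [F1 [q0 cF1 dT' FT FT']]]]]].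
  exists 1%:M, 1%:M, 1, F; split=> // x; first by rewrite mulmx1 mul1r.
  by rewrite mulmx1.
have [|U [U' [F2 [cF2 dU' FU FU']]]] := descent_three_steps p_pr n9 cF1.
  move=> U q' F2 q'0 cF2 FU; apply: (nF (U *m T) (q * q')) => //.
    by rewrite mulf_neq0.
  by move=> x; rewrite mulmxA FT FU mulrA.
exists (U *m T), (T' *m U'), (q * P ^+ 3), F2; split=> //.
- by rewrite mulf_neq0 ?expf_neq0 ?Posz_prime_neq0.
- by rewrite det_mulmx exprSr dvdz_mul.
- by move=> x; rewrite mulmxA FT FU mulrA.
- by move=> x; rewrite FT' FU' mulmxA.
Qed.

Lemma nondegenerate_smooth_zero F d L : (9 < n)%N -> cubic F -> d != 0 ->
  pol_mx F 1%:M *m L = d%:M ->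
  exists T q F1, [/\ q != 0, cubic F1,
    forall x, F (x *m T) = q * F1 x & smooth_zero_modp p F1].
Proof.
move=> n9 cF d0 ML; apply: contrapT => nF.
(* Enough rounds for a contradiction: with [k = |d ^ n|], [p ^ k] exceeds [|d ^ n|], yet it divides
   [det T'], a divisor of [d ^ n]. *)
have [|T [T' [q [F1 [_ cF1 dT' _ FT']]]]] :=
    @descent_iterate F `|d ^+ n|%N n9 cF.
  by move=> T q F1 q0 cF1 FT s; apply: nF; exists T, q, F1.
have dv : (\det T' %| d ^+ n)%Z.
  by rewrite -(@det_scalar _ n d) -ML (pol_mx_comp cF1 FT') -mulmxA det_mulmx dvdz_mulr.
have := dvdz_trans dT' dv; rewrite dvdzE abszX absz_nat => /dvdn_leq.
rewrite absz_gt0 expf_neq0 // => /(_ isT).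
by rewrite leqNgt ltn_expl // prime_gt1.
Qed.

End Descent.

(** * Coefficient arrays and degenerate forms over a field *)

Lemma sum3_pair (W : nmodType) (I : finType) (h : I -> I -> I -> W) :
  \sum_i \sum_j \sum_k h i j k = \sum_(x : I * I * I) h x.1.1 x.1.2 x.2.
Proof.
by rewrite (pair_bigA _ (fun i j => \sum_k h i j k)) /=
  (pair_bigA _ (fun x k => h x.1 x.2 k)).
Qed.

Lemma exchange_sum3 (W : nmodType) (I J : finType)
    (h : I -> I -> I -> J -> J -> J -> W) :
  \sum_i \sum_j \sum_k \sum_u \sum_v \sum_w h i j k u v w =
  \sum_u \sum_v \sum_w \sum_i \sum_j \sum_k h i j k u v w.
Proof.
rewrite !sum3_pair; under eq_bigr do rewrite sum3_pair.
by rewrite exchange_big /=; under [RHS]eq_bigr do rewrite sum3_pair.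
Qed.

Lemma sum3_delta (R : pzSemiRingType) (I : finType) (h : I -> I -> I -> R) i j k :
  \sum_u \sum_v \sum_w h u v w * ((u == i)%:R * (v == j)%:R * (w == k)%:R) =
  h i j k.
Proof.
rewrite (bigD1 i) //= [X in _ + X]big1 ?addr0 => [|u /negPf ->]; last first.
  by rewrite big1 // => v _; rewrite big1 // => w _; rewrite !mul0r mulr0.
rewrite (bigD1 j) //= [X in _ + X]big1 ?addr0 => [|v /negPf ->]; last first.
  by rewrite big1 // => w _; rewrite mulr0 mul0r mulr0.
rewrite (bigD1 k) //= [X in _ + X]big1 ?addr0 => [|w /negPf ->]; last first.
  by rewrite !mulr0.
by rewrite !eqxx !mulr1.
Qed.

Section Degenerate.
Import mpoly.
Variables (K : fieldType) (r : nat).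
Local Notation coefs := ('I_r -> 'I_r -> 'I_r -> K).
Implicit Types (a s : coefs) (T : 'M[K]_r).

Definition coefs_comp s T : coefs := fun i j k =>
  \sum_u \sum_v \sum_w s u v w * (T u i * T v j * T w k).

Lemma sum_coefs_comp s T (Y : 'I_r -> {mpoly K[r]}) :
  \sum_i \sum_j \sum_k coefs_comp s T i j k *: (Y i * Y j * Y k) =
  \sum_u \sum_v \sum_w s u v w *: ((\sum_i T u i *: Y i) *
    (\sum_j T v j *: Y j) * (\sum_k T w k *: Y k)).
Proof.
pose G i j k u v w := (s u v w * (T u i * T v j * T w k)) *: (Y i * Y j * Y k).
transitivity (\sum_i \sum_j \sum_k \sum_u \sum_v \sum_w G i j k u v w).
  do 3!apply: eq_bigr => ? _.
  rewrite scaler_suml; apply: eq_bigr => u _; rewrite scaler_suml.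
  by apply: eq_bigr => v _; rewrite scaler_suml.
rewrite exchange_sum3; apply: eq_bigr => u _; apply: eq_bigr => v _.
apply: eq_bigr => w _.
rewrite mulr_suml mulr_suml scaler_sumr; apply: eq_bigr => i _.
rewrite [T u i *: Y i * _]mulr_sumr mulr_suml scaler_sumr; apply: eq_bigr => j _.
rewrite mulr_sumr scaler_sumr; apply: eq_bigr => k _.
by rewrite -!scalerAl -!scalerAr -!scalerAl !scalerA /G; congr (_ *: _); ring.
Qed.

Lemma cubic_form_homog a : cubic_form a \is 3.-homog.
Proof.
do 3!(apply: rpred_sum => ? _); rewrite rpredZ //.
have hX i : ('X_i : {mpoly K[r]}) \is 1.-homog by rewrite dhomogX /= mdeg1.
by apply: (@dhomogM _ _ _ 2 _ 1) => //; apply: (@dhomogM _ _ _ 1 _ 1).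
Qed.

Lemma comp_cubic_form a (lq : r.-tuple {mpoly K[r]}) : cubic_form a \mPo lq =
  \sum_i \sum_j \sum_k a i j k *: (tnth lq i * tnth lq j * tnth lq k).
Proof.
rewrite /cubic_form raddf_sum; apply: eq_bigr => i _; rewrite raddf_sum.
apply: eq_bigr => j _; rewrite raddf_sum; apply: eq_bigr => k _ /=.
by rewrite comp_mpolyZ !rmorphM /= !comp_mpolyXU -!tnth_nth.
Qed.

Lemma equiv_coefs_comp c s T T' : T *m T' = 1%:M ->
  form_equiv (c *: cubic_form s) (c *: cubic_form (coefs_comp s T)).
Proof.
move=> TT'; exists T'; first by case/mulmx1_unit: TT'.
rewrite comp_mpolyZ comp_cubic_form; congr (_ *: _).
pose Y i : {mpoly K[r]} := \sum_j T' i j *: 'X_j.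
transitivity (\sum_i \sum_j \sum_k coefs_comp s T i j k *: (Y i * Y j * Y k));
  last by do 3!(apply: eq_bigr => ? _); rewrite !tnth_mktuple.
rewrite sum_coefs_comp.
have E u : \sum_i T u i *: Y i = 'X_u.
  rewrite /Y; under eq_bigr do rewrite scaler_sumr.
  rewrite exchange_big (bigD1 u) //= [X in _ + X]big1 => [|j ju].
    rewrite addr0; under eq_bigr do rewrite scalerA.
    rewrite -scaler_suml; move/matrixP/(_ u u): TT'; rewrite !mxE eqxx => ->.
    by rewrite scale1r.
  under eq_bigr do rewrite scalerA.
  rewrite -scaler_suml; move/matrixP/(_ u j): TT'; rewrite !mxE eq_sym (negPf ju).
  by move=> ->; rewrite scale0r.
by do 3!(apply: eq_bigr => ? _); rewrite !E.
Qed.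

(** Taking [e] as the new basis vector [i0] removes the variable [X_i0], since each coefficient
    involving it contracts [s] with [e]; then [r - 1] variables suffice. *)
Lemma degenerate_form c s (e : 'I_r -> K) i0 : e i0 != 0 ->
  (forall j k, \sum_i e i * s i j k = 0) ->
  (forall j k, \sum_i e i * s j i k = 0) ->
  (forall j k, \sum_i e i * s j k i = 0) ->
  ~ nondegenerate_form (c *: cubic_form s).
Proof.
move=> e0 s1 s2 s3 [_ /(_ #|~: [set i0]|)].
suff H : equiv_in_vars (c *: cubic_form s) #|~: [set i0]|.
  by move/(_ H); rewrite cardsC1 card_ord; have := ltn_ord i0; lia.
pose w : 'cV[K]_r := \col_i e i - delta_mx i0 0.
pose d : 'rV[K]_r := delta_mx 0 i0.
have dw : d *m w = (e i0 - 1)%:M.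
  by apply/rowP => j; rewrite -rowE !ord1 !mxE !eqxx.
(* [T] is the identity with column [i0] replaced by [e]; [T'] is its inverse by the Sherman-Morrison
   formula, as [1 + d w = e i0]. *)
pose T := 1%:M + w *m d; pose T' := 1%:M - (e i0)^-1 *: (w *m d).
have TT' : T *m T' = 1%:M.
  have : (w *m d) *m (w *m d) = (e i0 - 1) *: (w *m d).
    by rewrite mulmxA -(mulmxA w) dw mul_mx_scalar -scalemxAl.
  rewrite /T /T'; move: (w *m d) => N NN.
  rewrite mulmxBr mulmx1 -scalemxAr mulmxDl mul1mx NN.
  have -> : N + (e i0 - 1) *: N = e i0 *: N.
    by rewrite -{1}[N]scale1r -scalerDl addrC subrK.
  by rewrite scalerA mulVf // scale1r addrK.
have TE u j : T u j = if j == i0 then e u else (u == j)%:R.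
  rewrite mxE mxE mxE big_ord1 !mxE eqxx /=.
  by have [->|] := eqVneq j i0; rewrite ?mulr1 ?mulr0 ?addr0 // andbT addrC subrK.
exists (c *: cubic_form (coefs_comp s T)), (~: [set i0]); split=> //.
- by rewrite rpredZ // cubic_form_homog.
- exact: equiv_coefs_comp TT'.
move=> m; rewrite mcoeff_msupp => mC i mi; rewrite !inE.
apply: contra mC => /eqP ii0; rewrite {i}ii0 in mi.
rewrite mcoeffZ /cubic_form !linear_sum /=; apply/eqP; rewrite big1 ?mulr0 // => i _.
rewrite linear_sum big1 // => j _; rewrite linear_sum big1 // => k _ /=.
rewrite mcoeffZ -!mpolyXD mcoeffX.
have [ii|ni] := eqVneq i i0.
  rewrite /coefs_comp exchange_big big1 ?mul0r // => v _.
  rewrite exchange_big big1 // => l _ /=.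
  rewrite (eq_bigr (fun u => e u * s u v l * (T v j * T l k))) => [|u _].
    by rewrite -mulr_suml s1 mul0r.
  by rewrite ii [T u i0]TE eqxx; ring.
have [jj|nj] := eqVneq j i0.
  rewrite /coefs_comp big1 ?mul0r // => u _.
  rewrite exchange_big big1 // => l _ /=.
  rewrite (eq_bigr (fun v => e v * s u v l * (T u i * T l k))) => [|v _].
    by rewrite -mulr_suml s2 mul0r.
  by rewrite jj [T v i0]TE eqxx; ring.
have [kk|nk] := eqVneq k i0.
  rewrite /coefs_comp big1 ?mul0r // => u _; rewrite big1 // => v _ /=.
  rewrite (eq_bigr (fun l => e l * s u v l * (T u i * T v j))) => [|l _].
    by rewrite -mulr_suml s3 mul0r.
  by rewrite kk [T l i0]TE eqxx; ring.
case: eqP => [mE|_]; last by rewrite mulr0.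
by move: mi; rewrite -mE !mnmDE !mnm1E (negPf ni) (negPf nj) (negPf nk).
Qed.

Definition sym_coefs (R : nmodType) (a : 'I_r -> 'I_r -> 'I_r -> R) i j k :=
  a i j k + a i k j + a j i k + a j k i + a k i j + a k j i.

(** The six permuted arrays define the same polynomial, since the variables commute. *)
Lemma cubic_form_sym a : 6%:R != 0 :> K ->
  cubic_form a = 6%:R^-1 *: cubic_form (sym_coefs a).
Proof.
move=> six; have C12 b : cubic_form (fun i j k => b j i k) = cubic_form b :> {mpoly K[r]}.
  rewrite /cubic_form exchange_big; do 3!(apply: eq_bigr => ? _).
  by congr (_ *: _); ring.
have C23 b : cubic_form (fun i j k => b i k j) = cubic_form b :> {mpoly K[r]}.
  rewrite /cubic_form; apply: eq_bigr => i _; rewrite exchange_big.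
  by do 2!(apply: eq_bigr => ? _); congr (_ *: _); ring.
have -> : cubic_form (sym_coefs a) = cubic_form a + cubic_form (fun i j k => a i k j)
   + cubic_form (fun i j k => a j i k) + cubic_form (fun i j k => a j k i)
   + cubic_form (fun i j k => a k i j) + cubic_form (fun i j k => a k j i).
  rewrite /cubic_form -!big_split; apply: eq_bigr => i _.
  rewrite -!big_split; apply: eq_bigr => j _.
  rewrite -!big_split; apply: eq_bigr => k _ /=.
  by rewrite -!scalerDl.
rewrite (C12 (fun i j k => a k i j)) (C12 (fun i j k => a i k j)).
rewrite (C23 (fun i j k => a j i k)) (C12 a) (C23 a).
have -> (x : {mpoly K[r]}) : x + x + x + x + x + x = 6%:R *: x.
  by rewrite scaler_nat !mulrS addr0 !addrA.
by rewrite scalerA mulVf // scale1r.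
Qed.

Lemma degenerate_form_sym a (e : 'I_r -> K) i0 : 6%:R != 0 :> K -> e i0 != 0 ->
  (forall j k, \sum_i e i * sym_coefs a i j k = 0) ->
  ~ nondegenerate_form (cubic_form a).
Proof.
move=> six e0 s1; rewrite cubic_form_sym //; apply: (degenerate_form e0) => // j k.
  by rewrite -[RHS](s1 j k); apply: eq_bigr => i _; rewrite /sym_coefs; congr (_ * _); ring.
by rewrite -[RHS](s1 j k); apply: eq_bigr => i _; rewrite /sym_coefs; congr (_ * _); ring.
Qed.

End Degenerate.

(** * Hensel lifting and density in Q_p *)

(** Newton iteration on [s -> F (e + s d)] from [s = 0], within the integers. Keeping [s] divisible
    by [p] keeps the derivative congruent to [b], a unit mod [p]; the start needs [p | t] because
    [p | a]. *)
Lemma smooth_zero_values p n (F : 'rV[int]_n -> int) (t : int) N :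
  prime p -> smooth_zero_modp p F -> (p%:Z %| t)%Z ->
  exists x k, F x = t + p%:Z ^+ N.+1 * k.
Proof.
move=> p_pr [e [d [a [b [c [c' [FE pa pb]]]]]]] pt; set P := p%:Z in pa pb pt *.
suff [s [k [_ sE]]] : exists s k, (P %| s)%Z /\
    a + b * s + c * s ^+ 2 + c' * s ^+ 3 = t + P ^+ N.+1 * k.
  by exists (e + s *: d), k; rewrite FE.
elim: N => [|N [s [k [ps sE]]]].
  have /dvdzP[k aE] := pa; have /dvdzP[l tE] := pt.
  by exists 0, (k - l); split; rewrite ?dvdz0 // aE tE; ring.
pose b' := b + 2 * c * s + 3 * c' * s ^+ 2.
have pb' : ~~ (P %| b')%Z.
  have -> : b' = s * (2 * c + 3 * c' * s) + b by rewrite /b'; ring.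
  by rewrite dvdz_addr_id // dvdz_mulr.
(* [b'] is the derivative at [s], and [h] is the Newton correction [-k / b'] mod [p]. *)
have [u [v uv]] := prime_inv_mod p_pr pb'; pose h := - u * k.
pose D := P ^+ N.+1 * h.
exists (s + D), (- v * k + P ^+ N * h ^+ 2 * (c + 3 * c' * s + c' * D)); split.
  by rewrite rpredD // /D exprS -!mulrA dvdz_mulr.
transitivity (t + P ^+ N.+1 * k + D * b' + D ^+ 2 * (c + 3 * c' * s + c' * D)).
  by rewrite -sE /b'; ring.
have hb : h * b' = - k - v * k * P by rewrite /h mulrAC mulNr uv; ring.
have -> : D * b' = P ^+ N.+1 * (- k - v * k * P) by rewrite /D -mulrA hb.
move: (c + _ + _) => w; rewrite /D [P ^+ N.+2]exprS [P ^+ N.+1]exprS.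
by move: (P ^+ N) => q; ring.
Qed.

Lemma fraction_div (R : idomainType) (z : {fraction R}) :
  exists u v : R, v != 0 /\ z = FracField.tofrac u / FracField.tofrac v.
Proof.
elim/quotW: z => x; have x0 := denom_ratioP x.
exists (frac x).1, (frac x).2; split; first exact: x0.
have v0 : FracField.tofrac (frac x).2 != 0 by rewrite tofrac_eq0.
apply: (mulIf v0); rewrite divfK //; unlock FracField.tofrac.
rewrite -[LHS]FracField.pi_mul; apply/eqmodP; rewrite /= FracField.equivfE.
by rewrite !numden_Ratio ?(oner_neq0, mulf_neq0) //; apply/eqP; ring.
Qed.

(** * Arithmetic and approximation in [Z_p] and [Q_p] *)

Section PadicFacts.
Variables (p : nat) (p_pr : prime p).
Local Notation Zp := (padic_int p_pr).
Local Notation Qp := (padic p_pr).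
Local Notation iota := (@padic_of_int p p_pr).

Lemma padic_nat k n : (k%:R : Zp) n = (k %% p ^ n)%N.
Proof.
elim: k => [|k IH]; first by rewrite /= mod0n.
by rewrite mulrSr /= IH modnDm addn1.
Qed.

Lemma padic_residue0 (x : Zp) : x 0%N = 0%N.
Proof. by have := padic_residue_lt x 0; rewrite expn0; case: (x 0%N). Qed.

(** The quotient is a shift: its residue at [n] is that of [x] at [n + M], divided by [p ^ M]. *)
Lemma padic_divisible (x : Zp) M : x M = 0%N -> exists y, x = p%:R ^+ M * y.
Proof.
move=> xM; have px n : (p ^ M %| x (n + M))%N.
  by rewrite /dvdn padic_residue_le ?leq_addl // xM.
have pM : (0 < p ^ M)%N by rewrite expn_gt0 prime_gt0.
have fP n : (x (n.+1 + M) %/ p ^ M = x (n + M) %/ p ^ M %[mod p ^ n])%N.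
  rewrite !modn_divl -expnD; congr (_ %/ _)%N.
  by rewrite addSn padic_residueP padic_residue_mod.
exists (padic_mk p_pr fP); apply: padic_int_ext => n.
rewrite -natrX /= padic_nat modnMmr modnMml mulnC divnK //.
by rewrite padic_residue_le ?leq_addr.
Qed.

Lemma padic_unit_residue (x : Zp) : x 1%N != 0%N -> exists y, y * x = 1.
Proof.
move=> x1; have cop n : coprime (p ^ n) (x n).
  case: n => [|n]; first by rewrite expn0 coprime1n.
  rewrite coprime_pexpl // prime_coprime //.
  by rewrite /dvdn -[X in (_ %% X)%N]expn1 padic_residue_le.
have inv n : exists k, (k * x n = 1 %[mod p ^ n])%N.
  case: n => [|n]; first by exists 0%N; rewrite expn0 !modn1.
  have xn : (0 < x n.+1)%N.
    rewrite lt0n; apply: contra x1 => /eqP x0.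
    by rewrite -(padic_residue_le x (isT : 1 <= n.+1)%N) x0 mod0n.
  case: (egcdnP (p ^ n.+1) xn) => u v uv _; exists u.
  by rewrite uv gcdnC (eqP (cop _)) modnMDl.
have [f fP] := choice inv.
(* Inverses mod [p ^ n] are unique, so independent choices at each level are compatible. *)
have fS n : (f n.+1 = f n %[mod p ^ n])%N.
  have e1 : (f n.+1 * x n = 1 %[mod p ^ n])%N.
    have := congr1 (fun k => k %% p ^ n)%N (fP n.+1).
    by rewrite !modn_dvdm ?dvdn_exp2l // -(padic_residueP x n) modnMmr.
  rewrite -[f n.+1]muln1 -modnMmr -(fP n) modnMmr mulnCA -modnMmr e1 modnMmr.
  by rewrite muln1.
exists (padic_mk p_pr fS); apply: padic_int_ext => n /=.
by rewrite modnMml fP.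
Qed.

Lemma padic_dvd_pow (x : Zp) : x != 0 -> exists b y, x * y = p%:R ^+ b.
Proof.
(* The residue at 0 is taken mod 1 and is always 0, so the first nonzero one has index [b + 1],
   where [b] is the valuation of [x]. *)
move=> /padic_neq0P exx; have [[|b] xb minb] := ex_minnP exx.
  by rewrite padic_residue0 eqxx in xb.
have [|z xE] := @padic_divisible x b.
  by apply/eqP/negPn/negP => /minb; rewrite ltnn.
have [|y yz] := @padic_unit_residue z.
  apply: contra xb => /eqP z1.
  have [z' zE] := padic_divisible z1.
  by rewrite xE zE mulrA -exprSr -natrX /= padic_nat modnn mul0n mod0n.
by exists b, y; rewrite xE -mulrA [z * y]mulrC yz mulr1.
Qed.

Lemma padic_approx (x : Zp) M : exists y, x = (x M)%:R + p%:R ^+ M * y.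
Proof.
have [|y yE] := @padic_divisible (x - (x M)%:R) M; last first.
  by exists y; rewrite -yE addrC subrK.
rewrite /= padic_nat padic_residue_mod modnDmr subnKC ?modnn //.
exact/ltnW/padic_residue_lt.
Qed.

Lemma padic_int_neq0 (m : int) : m != 0 -> m%:~R != 0 :> Qp.
Proof.
suff H k : k.+1%:R != 0 :> Qp.
  case: m => [[//|k]|k] _; first exact: H.
  by rewrite NegzE mulrNz oppr_eq0; apply: H.
rewrite -(rmorph_nat (@FracField.tofrac Zp)) tofrac_eq0.
apply/eqP => /(congr1 (fun x : Zp => x k.+1)).
rewrite padic_nat /= mod0n modn_small //.
by apply: ltn_expl; apply: prime_gt1.
Qed.

Lemma padic_ratr (m d : int) : d != 0 -> ratr (m%:~R / d%:~R) = m%:~R / d%:~R :> Qp.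
Proof.
move=> d0; rewrite /ratr; set q := _ / _.
apply/eqP; rewrite eqr_div ?padic_int_neq0 ?denq_neq0 // -!rmorphM /=.
apply/eqP; congr (_ *~ _).
apply: (@intr_inj rat); rewrite !rmorphM /= numqE /q.
by rewrite mulrAC divfK ?intr_eq0.
Qed.

Lemma padic_frac (z : Qp) : exists u b, z = iota u / p%:R ^+ b.
Proof.
have [u [v [v0 ->]]] := fraction_div z.
have [b [y vy]] := padic_dvd_pow v0.
exists (u * y), b.
have vF : iota v != 0 by rewrite tofrac_eq0.
have pF : p%:R ^+ b != 0 :> Qp.
  by rewrite expf_neq0 // (@padic_int_neq0 p%:Z) // Posz_prime_neq0.
apply/eqP; rewrite eqr_div //; apply/eqP.
have -> : p%:R ^+ b = iota (v * y) by rewrite vy /padic_of_int rmorphXn rmorph_nat.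
by rewrite /padic_of_int -!rmorphM; congr FracField.tofrac; ring.
Qed.

Lemma padic_unit_1p (y : Zp) : exists h, h * (1 + p%:R * y) = 1.
Proof.
apply: padic_unit_residue.
by rewrite /= padic_nat expn1 modnn mul0n mod0n addn0 modn_mod modn_small ?prime_gt1.
Qed.

(** Write [z = u / p ^ b]. The values [A] and [B] are taken near [p u] and [p ^ (b + 1)], both
    multiples of [p], with quotient [z]. *)
Lemma padic_density_of_values (f : int -> Prop) :
  (forall t N, (p%:Z %| t)%Z -> exists k, f (t + p%:Z ^+ N.+1 * k)) ->
  forall (z : Qp) n, exists A B w, [/\ f A, f B, B != 0 &
    A%:~R / B%:~R = z + p%:R ^+ n * iota w].
Proof.
move=> fP z n; have [u [b ->]] := padic_frac z.
have p0 : p%:Z != 0 by apply: Posz_prime_neq0.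
(* [A * p ^ b - u * B] will be [p ^ M * X]; dividing by [B * p ^ b], which is [p ^ (2b + 1)] times a
   unit, leaves [p ^ (n + 2)]. *)
pose M := (b + n + 2 + b)%N.+1.
have [t uE] := padic_approx u M.
have [|s' fA] := fP (p%:Z * (u M)%:Z) M.-1; first by rewrite dvdz_mulr.
have [|s fB] := fP (p%:Z ^+ b.+1) M.-1; first by rewrite exprS dvdz_mulr.
set A := (X in f X) in fA; set B := (X in f X) in fB.
pose y : Zp := p%:R ^+ (b + n + 1) * s%:~R.
have [h hg] := padic_unit_1p y.
have BE : B%:~R = p%:R ^+ b.+1 * (1 + p%:R * y) :> Zp.
  rewrite /B rmorphD rmorphM !rmorphXn /= -pmulrn /y /M.
  by rewrite !addnS !addn0 !exprS !exprD; ring.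
have AE : A%:~R = p%:R * (u - p%:R ^+ M * t) + p%:R ^+ M * s'%:~R :> Zp.
  by rewrite /A rmorphD !rmorphM !rmorphXn /= -!pmulrn [in RHS]uE addrK.
pose X : Zp := - p%:R ^+ b.+1 * t + p%:R ^+ b * s'%:~R - u * s%:~R.
have B0 : B%:~R != 0 :> Zp.
  rewrite BE mulf_neq0 // ?expf_neq0 //.
    by rewrite -tofrac_eq0 rmorph_nat (@padic_int_neq0 p%:Z).
  by apply/eqP => g0; move/eqP: hg; rewrite g0 mulr0 eq_sym oner_eq0.
exists A, B, (p%:R ^+ 2 * X * h); split=> //.
  by apply: contra B0 => /eqP ->.
have key : A%:~R * p%:R ^+ b =
    (u + p%:R ^+ n * (p%:R ^+ 2 * X * h) * p%:R ^+ b) * B%:~R :> Zp.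
  have -> : (u + p%:R ^+ n * (p%:R ^+ 2 * X * h) * p%:R ^+ b) * B%:~R =
      u * B%:~R + p%:R ^+ n * p%:R ^+ 2 * X * p%:R ^+ b * p%:R ^+ b.+1 *
      (h * (1 + p%:R * y)).
    by rewrite BE; ring.
  rewrite hg AE BE /X /y /M !addnS !addn0 !exprS !exprD; ring.
have BF : B%:~R != 0 :> Qp by apply: padic_int_neq0; apply: contra B0 => /eqP ->.
have pF : p%:R ^+ b != 0 :> Qp by rewrite expf_neq0 // (@padic_int_neq0 p%:Z).
apply: (mulIf BF); rewrite divfK //; apply: (mulIf pF).
rewrite mulrAC mulrDl divfK //.
move: (p%:R ^+ 2 * X * h) key => w key; clearbody A B.
have := congr1 iota key; rewrite /padic_of_int !rmorphM !rmorphD !rmorphM !rmorphXn /=.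
by rewrite !rmorph_nat !rmorph_int.
Qed.

End PadicFacts.

(** * The integral cubic form as a function, and its polarization *)

Section IntegralCubicForm.
Import mpoly.
Variables (r : nat) (a : 'I_r -> 'I_r -> 'I_r -> int).
Let F (x : 'rV[int]_r) : int := (cubic_form a).@[x 0].

Lemma meval_cubic_form x :
  F x = \sum_i \sum_j \sum_k a i j k * (x 0 i * x 0 j * x 0 k).
Proof.
rewrite /F /cubic_form raddf_sum; apply: eq_bigr => i _.
rewrite raddf_sum; apply: eq_bigr => j _; rewrite raddf_sum; apply: eq_bigr => k _.
by rewrite /= mevalZ !mevalM !mevalXU.
Qed.

Lemma cubic_meval_cubic_form : cubic F.
Proof.
apply: (@eq_cubic _ (fun x => \sum_i \sum_j \sum_k a i j k * (x 0 i * x 0 j * x 0 k))).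
  by move=> x; rewrite meval_cubic_form.
do 3!(apply: cubic_sum => ?).
by apply/cubic_scale/cubic_lin; apply: lin_coord.
Qed.

Lemma pol_meval_cubic_form i j k :
  pol F (delta_mx 0 i) (delta_mx 0 j) (delta_mx 0 k) = sym_coefs a i j k.
Proof.
rewrite /pol !meval_cubic_form !sum3_pair -!sumrB -!big_split.
rewrite /sym_coefs -(sum3_delta a i j k) -(sum3_delta a i k j).
rewrite -(sum3_delta a j i k) -(sum3_delta a j k i).
rewrite -(sum3_delta a k i j) -(sum3_delta a k j i) !sum3_pair -!big_split.
by apply: eq_bigr => u _ /=; rewrite !mxE !eqxx /=; ring.
Qed.

Lemma extend_cubic_form (K : comNzRingType) :
  extend_scalars K (cubic_form a) = cubic_form (fun i j k => (a i j k)%:~R).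
Proof.
rewrite /extend_scalars /cubic_form raddf_sum; apply: eq_bigr => i _.
rewrite raddf_sum; apply: eq_bigr => j _; rewrite raddf_sum; apply: eq_bigr => k _.
by rewrite /= map_mpolyZ !rmorphM /= !map_mpolyX.
Qed.

(** A kernel vector of the polar matrix would stay nonzero in [K] and annihilate the symmetrized
    coefficients, making the form degenerate over [K]. *)
Lemma nondegenerate_pol_mx_inverse (K : fieldType) :
  (forall m : int, m != 0 -> m%:~R != 0 :> K) ->
  nondegenerate_form (extend_scalars K (cubic_form a)) ->
  exists2 d : int, d != 0 & exists L, pol_mx F 1%:M *m L = d%:M.
Proof.
move=> char0 nd; case: (pol_mx_kernel_or_inverse F) => // -[e e0 eM].
have [i0 ei0] : exists i, e 0 i != 0.
  apply: contrapT => H; case/eqP: e0; apply/rowP => i; rewrite mxE.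
  by apply/eqP/negPn/negP => ei; apply: H; exists i.
case: (@degenerate_form_sym K r (fun i j k => (a i j k)%:~R)
  (fun i => (e 0 i)%:~R) i0); rewrite -?extend_cubic_form //.
- exact: (char0 6).
- exact: char0.
move=> j k; move/rowP/(_ (mxvec_index j k)): eM; rewrite !mxE.
under eq_bigr do rewrite pol_mxE !mulmx1 pol_meval_cubic_form.
move=> /(congr1 (intr : int -> K)); rewrite rmorph_sum /= mulr0z => s0.
rewrite -[RHS]s0.
by apply: eq_bigr => i _; rewrite rmorphM /sym_coefs !rmorphD.
Qed.

End IntegralCubicForm.

Theorem theorem1p4 (p : nat) (p_pr : prime p) (r : nat) (r_gt9 : (9 < r)%N)
    (a : 'I_r -> 'I_r -> 'I_r -> int)
    (a_primitive : primitive_coefs a)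
    (C_nondegenerate :
       nondegenerate_form (extend_scalars (padic p_pr) (cubic_form a))) :
  dense ([set ratr q | q in ratio_set (cubic_form a)]%classic
           : set (padic p_pr)).
Proof.
have [d d0 [L ML]] :=
  nondegenerate_pol_mx_inverse (@padic_int_neq0 p p_pr) C_nondegenerate.
have cF := cubic_meval_cubic_form a.
have [T [q [F1 [q0 cF1 FT sF1]]]] := nondegenerate_smooth_zero p_pr r_gt9 cF d0 ML.
move=> O [z Oz]; rewrite padic_openE => /(_ z Oz)[n nO].
have [|A [B [w [[x xA] [y yB] B0 AB]]]] :=
    @padic_density_of_values p p_pr (fun t => exists x, F1 x = t) _ z n.
  move=> t N pt; have [x [k xE]] := smooth_zero_values N p_pr sF1 pt.
  by exists k, x.
exists (z + p%:R ^+ n * padic_of_int w); split; first by apply: nO; exists w.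
(* [A] and [B] are values of [F1], so [q * A] and [q * B] are values of the given form at [x *m T]
   and [y *m T], and [q] cancels in the ratio. *)
exists ((q * A)%:~R / (q * B)%:~R).
  exists ((x *m T) 0), ((y *m T) 0); split.
    by rewrite [mpoly.meval _ _]FT yB; apply/eqP; rewrite mulf_neq0.
  by rewrite [mpoly.meval ((x *m T) 0) _]FT [mpoly.meval _ _]FT xA yB.
rewrite padic_ratr ?mulf_neq0 // -AB !rmorphM /=.
by rewrite -mulf_div divff ?mul1r // padic_int_neq0.
Qed.
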